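(* Let $V \in \mathcal{H}^{r\times n}$ and $Y\in\mathcal{H}^{n\times r}$ be a left and a right canonical matrix, respectively, for $T$ at $\lambda_0$. Then $VTY$ is invertible as a meromorphic matrix, and: (i) $\hat Y := Y(VTY)^{-1}\Delta$ is a right canonical matrix for $T$ at $\lambda_0$ and satisfies the biorthogonality condition $\Delta^{-1}VT\hat Y\Delta^{-1}\doteq\Delta^{-1}$; (ii) $\hat V := \Delta(VTY)^{-1}V$ is a left canonical matrix for $T$ at $\lambda_0$ and satisfies $\Delta^{-1}\hat V TY\Delta^{-1}\doteq\Delta^{-1}$; (iii) $T^{-1}\doteq Y(VTY)^{-1}V$.
   Context: Let $\Omega\subset\mathbb{C}$ be open and $\lambda_0\in\Omega$ fixed. $\mathcal{H}$ denotes the ring of holomorphic functions on $\Omega$, $\mathcal{M}$ the field of meromorphic functions on $\Omega$, and $\mathcal{H}_0$ the ring of functions holomorphic in some neighborhood of $\lambda_0$. Write $\chi_0(\lambda)=\lambda-\lambda_0$. A matrix $M\in\mathcal{H}_0^{n\times n}$ is unimodular if it has an inverse in $\mathcal{H}_0^{n\times n}$ (equivalently, $M(\lambda_0)$ is nonsingular); $M\in\mathcal{H}_0^{n\times m}$ is left (right) unimodular if it has a left (right) inverse with entries in $\mathcal{H}_0$. For meromorphic matrices $M_1,M_2$ of equal size, $M_1\doteq M_2$ means that $M_2-M_1$ is holomorphic in a neighborhood of $\lambda_0$ (equal principal parts at $\lambda_0$). Throughout, $T\in\mathcal{H}^{n\times n}$ with $\det T$ not identically zero and $\det T(\lambda_0)=0$,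 and $r=\dim\ker T(\lambda_0)$. There exist unimodular $U_L,U_R\in\mathcal{H}_0^{n\times n}$ and uniquely determined integers $m_1\ge\cdots\ge m_n\ge 0$ (the partial multiplicities) with $U_LTU_R=\mathrm{diag}(\chi_0^{m_1},\dots,\chi_0^{m_n})$; one has $m_i>0$ exactly for $i\le r$. Set $\Delta=\mathrm{diag}(\chi_0^{m_1},\dots,\chi_0^{m_r})\in\mathcal{H}_0^{r\times r}$. A root function for $T$ at $\lambda_0$ is $y\in\mathcal{H}^n$ with $y(\lambda_0)\neq0$ and $T(\lambda_0)y(\lambda_0)=0$; its multiplicity $\nu(y)$ is the order of the zero of $Ty$ at $\lambda_0$. A right canonical matrix for $T$ at $\lambda_0$ is $Y\in\mathcal{H}^{n\times r}$ whose columns $y_1,\dots,y_r$ are root functions such that (a) $y_1(\lambda_0),\dots,y_r(\lambda_0)$ are linearly independent, (b) $\sum_{i=1}^r\nu(y_i)=\sum_{i=1}^r m_i$, (c) $\nu(y_1)\ge\cdots\ge\nu(y_r)$. A left root function is a row vector $v\in\mathcal{H}^{1\times n}$ with $v(\lambda_0)\ne0$ and $v(\lambda_0)T(\lambda_0)=0$, with multiplicity the order of the zero of $vT$ at $\lambda_0$; a left canonical matrix $V\in\mathcal{H}^{r\times n}$ is defined analogously (rows are left root functions satisfying the analogues of (a),(b),(c)).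
   Formalization: Ŷ and V̂ are shown to be canonical matrices with entries holomorphic near λ0 (in H_0, after removing the singularity) rather than on all of Ω; the literal claim fails for T=λ, λ0=0, V=Y=1−λ on C, where Ŷ=1/(1−λ). *)

(* Defs.v *)
(* The complex field is R[i] for an
   arbitrary R : realType; holomorphy = complex differentiability
   (derivable over the scalar field R[i] in direction 1). *)
From HB Require Import structures.
From mathcomp Require Import all_boot all_order all_algebra.
From mathcomp Require Import complex.
From mathcomp Require Import all_classical all_reals all_analysis.
Import numFieldNormedType.Exports.
Set Implicit Arguments.
Unset Strict Implicit.
Unset Printing Implicit Defensive.
Import Order.TTheory GRing.Theory Num.Theory.
Local Open Scope ring_scope.
Local Open Scope classical_set_scope.

Section Defs.
Context {R : realType}.
Local Notation C := (R[i]).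

Definition cdiff (f : C -> C) (z : C) : Prop :=
  derivable (f : C^o -> C^o) z 1.

Definition mx_holoOn (A : set C) p q (M : C -> 'M[C]_(p, q)) : Prop :=
  forall i j, forall z, A z -> cdiff (fun w => M w i j) z.

Definition mx_holo_near (l0 : C) p q (M : C -> 'M[C]_(p, q)) : Prop :=
  \forall z \near (l0 : C^o), forall i j, cdiff (fun w => M w i j) z.

Definition unimodular (l0 : C) n (M : C -> 'M[C]_n) : Prop :=
  mx_holo_near l0 M /\
  exists N : C -> 'M[C]_n, mx_holo_near l0 N /\
    \forall z \near (l0 : C^o), M z *m N z = 1%:M /\ N z *m M z = 1%:M.

Definition zero_order (l0 : C) p q (f : C -> 'M[C]_(p, q)) (k : nat) : Prop :=
  exists g : C -> 'M[C]_(p, q), mx_holo_near l0 g /\ g l0 != 0 /\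
    \forall z \near (l0 : C^o), f z = (z - l0) ^+ k *: g z.

Definition Delta (l0 : C) (m : nat -> nat) (r : nat) : C -> 'M[C]_r :=
  fun z => diag_mx (\row_(i < r) (z - l0) ^+ m i).

(* right canonical matrix for T at l0, with columns in H_0^n
   (m = partial multiplicities, r = dim ker T(l0)) *)
Definition right_canonical (l0 : C) n (T : C -> 'M[C]_n) (m : nat -> nat) r
    (Y : C -> 'M[C]_(n, r)) : Prop :=
  mx_holo_near l0 Y /\
  (forall i : 'I_r, col i (Y l0) != 0 /\ T l0 *m col i (Y l0) = 0) /\
  row_free (Y l0)^T /\
  exists nu : 'I_r -> nat,
    (forall i : 'I_r, zero_order l0 (fun z => T z *m col i (Y z)) (nu i)) /\
    (\sum_(i < r) nu i = \sum_(i < r) m i)%N /\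
    (forall i j : 'I_r, (i <= j)%N -> (nu j <= nu i)%N).

Definition left_canonical (l0 : C) n (T : C -> 'M[C]_n) (m : nat -> nat) r
    (V : C -> 'M[C]_(r, n)) : Prop :=
  mx_holo_near l0 V /\
  (forall i : 'I_r, row i (V l0) != 0 /\ row i (V l0) *m T l0 = 0) /\
  row_free (V l0) /\
  exists nu : 'I_r -> nat,
    (forall i : 'I_r, zero_order l0 (fun z => row i (V z) *m T z) (nu i)) /\
    (\sum_(i < r) nu i = \sum_(i < r) m i)%N /\
    (forall i j : 'I_r, (i <= j)%N -> (nu j <= nu i)%N).

(* The meromorphic matrix M (given by its values off l0) is holomorphic at l0
   (removable singularity) and its holomorphic germ satisfies P. *)
Definition germ_holo_with (l0 : C) p q (M : C -> 'M[C]_(p, q))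
    (P : (C -> 'M[C]_(p, q)) -> Prop) : Prop :=
  exists Mh : C -> 'M[C]_(p, q), P Mh /\ \forall z \near (l0 : C^o), z != l0 -> Mh z = M z.

Definition peq (l0 : C) p q (M1 M2 : C -> 'M[C]_(p, q)) : Prop :=
  exists h : C -> 'M[C]_(p, q), mx_holo_near l0 h /\
    \forall z \near (l0 : C^o), z != l0 -> M2 z - M1 z = h z.

End Defs.

(* Main.v *)
Require Import Defs.
From HB Require Import structures.
From mathcomp Require Import all_boot all_order all_algebra.
From mathcomp Require Import fingroup perm complex.
From mathcomp Require Import all_classical all_reals all_analysis.
Import numFieldNormedType.Exports.
Import Order.TTheory GRing.Theory Num.Theory.
Local Open Scope ring_scope.
Local Open Scope classical_set_scope.

(** In local Smith coordinates the definition of canonical matrices says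
    [T Y = W Delta_nu] and [V T = Delta_mu Z] with [W], [Z] holomorphic.
    Since [nu] and [m] have the same sum, comparing determinants shows that the
    block of [W] complementary to the range of [T l0] is invertible, and a nonzero
    term in its Leibniz expansion forces [nu = m]; likewise [mu = m].  Hence
    [V T Y = (V W) Delta = Delta (Z Y)] with [V W] and [Z Y] unimodular, so that
    [Yhat = Y (Z Y)^-1] and [T Yhat = W (V W)^-1 Delta].  For (iii), put
    [P = 1 - W (V W)^-1 V]; then [T^-1 - Y (V T Y)^-1 V = T^-1 P], and this is
    holomorphic because [V P = 0]. *)

Set Implicit Arguments.
Unset Strict Implicit.
Unset Printing Implicit Defensive.

(** * Complex differentiability of scalar functions and the neighbourhood filter at a point *)

Section Holomorphy.
Context {R : realType}.
Local Notation C := R[i].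
Implicit Types (f g : C -> C) (z l : C).

Lemma cdiff_cst (c z : C) : cdiff (fun=> c) z.
Proof. exact: (@derivable_cst _ C^o C^o c z 1). Qed.

Lemma cdiffD f g z : cdiff f z -> cdiff g z -> cdiff (fun w => f w + g w) z.
Proof. exact: (@derivableD _ C^o C^o f g z 1). Qed.

Lemma cdiffB f g z : cdiff f z -> cdiff g z -> cdiff (fun w => f w - g w) z.
Proof. exact: (@derivableB _ C^o C^o f g z 1). Qed.

Lemma cdiffM f g z : cdiff f z -> cdiff g z -> cdiff (fun w => f w * g w) z.
Proof. exact: (@derivableM _ C^o f g z 1). Qed.

Lemma cdiffV f z : f z != 0 -> cdiff f z -> cdiff (fun w => (f w)^-1) z.
Proof. exact: (@derivableV _ C^o f z 1). Qed.

Lemma cdiff_subl0 l0 z : cdiff (fun w => w - l0) z.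
Proof.
by apply: cdiffB; [exact: (@derivable_id _ C^o z 1) | exact: cdiff_cst].
Qed.

Lemma cdiff_sum (I : Type) (s : seq I) (P : pred I) (F : I -> C -> C) z :
  (forall i, cdiff (F i) z) -> cdiff (fun w => \sum_(i <- s | P i) F i w) z.
Proof.
move=> dF; elim: s => [|i s IHs].
  by under eq_fun do rewrite big_nil; exact: cdiff_cst.
under eq_fun do rewrite big_cons.
case: (P i); last exact: IHs.
by apply: cdiffD; [exact: dF | exact: IHs].
Qed.

Lemma cdiff_prod (I : Type) (s : seq I) (P : pred I) (F : I -> C -> C) z :
  (forall i, cdiff (F i) z) -> cdiff (fun w => \prod_(i <- s | P i) F i w) z.
Proof.
move=> dF; elim: s => [|i s IHs].
  by under eq_fun do rewrite big_nil; exact: cdiff_cst.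
under eq_fun do rewrite big_cons.
case: (P i); last exact: IHs.
by apply: cdiffM; [exact: dF | exact: IHs].
Qed.

Lemma cdiffX f k z : cdiff f z -> cdiff (fun w => f w ^+ k) z.
Proof.
move=> df; elim: k => [|k IHk].
  by under eq_fun do rewrite expr0; exact: cdiff_cst.
by under eq_fun do rewrite exprS; exact: cdiffM.
Qed.

Lemma cdiff_det n (M : C -> 'M[C]_n) z :
  (forall i j, cdiff (fun w => M w i j) z) -> cdiff (fun w => \det (M w)) z.
Proof.
move=> dM; apply: cdiff_sum => s; apply: cdiffM; first exact: cdiff_cst.
exact: cdiff_prod.
Qed.

Lemma cdiff_continuous f z : cdiff f z -> {for z, continuous (f : C^o -> C^o)}.
Proof.
by move=> df; apply: differentiable_continuous; exact/derivable1_diffP.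
Qed.

Lemma near_imp (l0 : C) (P Q : C -> Prop) : (forall z, P z -> Q z) ->
  (\forall z \near (l0 : C^o), P z) -> \forall z \near (l0 : C^o), Q z.
Proof. exact: filterS. Qed.

Lemma near_imp2 (l0 : C) (P Q S : C -> Prop) : (forall z, P z -> Q z -> S z) ->
  (\forall z \near (l0 : C^o), P z) -> (\forall z \near (l0 : C^o), Q z) ->
  \forall z \near (l0 : C^o), S z.
Proof. exact: filterS2. Qed.

Lemma near_and (l0 : C) (P Q : C -> Prop) :
  (\forall z \near (l0 : C^o), P z) -> (\forall z \near (l0 : C^o), Q z) ->
  \forall z \near (l0 : C^o), P z /\ Q z.
Proof. exact: filterI. Qed.

Lemma near_forall (l0 : C) (I : finType) (P : I -> C -> Prop) :
  (forall i, \forall z \near (l0 : C^o), P i z) ->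
  \forall z \near (l0 : C^o), forall i, P i z.
Proof. exact: (@filter_forall _ I P (nbhs (l0 : C^o))). Qed.

Lemma cdiff_near_neq0 f z :
  cdiff f z -> f z != 0 -> \forall w \near (z : C^o), f w != 0.
Proof.
move=> df fz0.
exact: (@cvgr_neq0 _ C^o C^o (nbhs (z : C^o)) _ f (f z) (cdiff_continuous df)).
Qed.

(* This replaces every appeal to removable singularities. *)
Lemma cdiff_eq_at f g l0 : cdiff f l0 -> cdiff g l0 ->
  (\forall z \near (l0 : C^o), z != l0 -> f z = g z) -> f l0 = g l0.
Proof.
move=> df dg fg; apply/eqP; rewrite -subr_eq0; apply: contraT => fg0.
have nz := cdiff_near_neq0 (cdiffB df dg) fg0.
(* The punctured neighbourhood filter is proper, so some [z != l0] satisfies both [f z = g z] and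
   [f z - g z != 0]. *)
have pl0 : (l0 : C^o)^' (fun z => z != l0) by exact: (@nbhs_dnbhs_neq C^o l0).
have [z [[zl0 fgz] nzz]] := filter_ex
  (filterI (filterI pl0 (nbhs_dnbhs fg)) (nbhs_dnbhs nz)).
by move: nzz; rewrite fgz // subrr eqxx.
Qed.

End Holomorphy.

(** * Matrices holomorphic near [l0] and local invertibility *)

Section HolomorphicMatrices.
Context {R : realType} (l0 : R[i]).
Local Notation C := R[i].
Local Notation holo := (mx_holo_near l0).

Lemma mx_holo_atP p q (M : C -> 'M[C]_(p, q)) :
  holo M -> forall i j, cdiff (fun w => M w i j) l0.
Proof. by move=> hM; exact: (nbhs_singleton hM). Qed.

Lemma mx_holo_cst p q (A : 'M[C]_(p, q)) : holo (fun=> A).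
Proof.
apply: (@near_imp _ l0 (fun=> True)); last exact: filterT.
by move=> z _ i j; exact: cdiff_cst.
Qed.

Lemma mx_holoB p q (M N : C -> 'M[C]_(p, q)) :
  holo M -> holo N -> holo (fun z => M z - N z).
Proof.
move=> hM hN; apply: near_imp2 hM hN => z dM dN i j.
under eq_fun do rewrite !mxE.
by apply: cdiffB; [exact: dM | exact: dN].
Qed.

Lemma mx_holoM p q s (M : C -> 'M[C]_(p, q)) (N : C -> 'M[C]_(q, s)) :
  holo M -> holo N -> holo (fun z => M z *m N z).
Proof.
move=> hM hN; apply: near_imp2 hM hN => z dM dN i j.
under eq_fun do rewrite !mxE.
by apply: cdiff_sum => k; apply: cdiffM; [exact: dM | exact: dN].
Qed.

Lemma mx_holo_tr p q (M : C -> 'M[C]_(p, q)) :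
  holo M -> holo (fun z => (M z)^T).
Proof.
move=> hM; apply: near_imp hM => z dM i j.
by under eq_fun do rewrite mxE; exact: dM.
Qed.

Lemma mx_holo_sub p q p' q' (f : 'I_p' -> 'I_p) (g : 'I_q' -> 'I_q)
    (M : C -> 'M[C]_(p, q)) :
  holo M -> holo (fun z => mxsub f g (M z)).
Proof.
move=> hM; apply: near_imp hM => z dM i j.
by under eq_fun do rewrite mxE; exact: dM.
Qed.

Lemma mx_holo_usub p1 p2 q (M : C -> 'M[C]_(p1 + p2, q)) :
  holo M -> holo (fun z => usubmx (M z)).
Proof.
by under [X in _ -> holo X]eq_fun do rewrite usubmxEsub; exact: mx_holo_sub.
Qed.

Lemma mx_holo_dsub p1 p2 q (M : C -> 'M[C]_(p1 + p2, q)) :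
  holo M -> holo (fun z => dsubmx (M z)).
Proof.
by under [X in _ -> holo X]eq_fun do rewrite dsubmxEsub; exact: mx_holo_sub.
Qed.

Lemma mx_holo_lsub p q1 q2 (M : C -> 'M[C]_(p, q1 + q2)) :
  holo M -> holo (fun z => lsubmx (M z)).
Proof.
by under [X in _ -> holo X]eq_fun do rewrite lsubmxEsub; exact: mx_holo_sub.
Qed.

Lemma mx_holo_rsub p q1 q2 (M : C -> 'M[C]_(p, q1 + q2)) :
  holo M -> holo (fun z => rsubmx (M z)).
Proof.
by under [X in _ -> holo X]eq_fun do rewrite rsubmxEsub; exact: mx_holo_sub.
Qed.

Lemma mx_holo_col_mx p1 p2 q (M : C -> 'M[C]_(p1, q)) (N : C -> 'M[C]_(p2, q)) :
  holo M -> holo N -> holo (fun z => col_mx (M z) (N z)).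
Proof.
move=> hM hN; apply: near_imp2 hM hN => z dM dN i j.
under eq_fun do rewrite mxE.
by case: (fintype.split i) => k; [exact: dM | exact: dN].
Qed.

Lemma mx_holo_cols p q (g : 'I_q -> C -> 'cV[C]_p) :
  (forall j, holo (g j)) -> holo (fun z => \matrix_(i, j) g j z i 0).
Proof.
move=> hg; apply: near_imp (near_forall hg) => z dg i j.
by under eq_fun do rewrite mxE; exact: dg.
Qed.

Lemma unitmx_near n (K : C -> 'M[C]_n) : holo K -> K l0 \in unitmx ->
  \forall z \near (l0 : C^o), K z \in unitmx.
Proof.
move=> hK; rewrite unitmxE unitfE => K0.
have := cdiff_near_neq0 (cdiff_det (mx_holo_atP hK)) K0.
by apply: near_imp => z; rewrite unitmxE unitfE.
Qed.

(** The determinant stays nonzero near [l0], so the adjugate divided by it is a holomorphic inverse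
    there. *)
Lemma unimodular_unit n (K : C -> 'M[C]_n) :
  holo K -> K l0 \in unitmx -> unimodular l0 K.
Proof.
move=> hK K0; have uK := unitmx_near hK K0; split=> //.
exists (fun z => (\det (K z))^-1 *: \adj (K z)); split.
  apply: near_imp2 hK uK => z dK; rewrite unitmxE unitfE => uz i j.
  under eq_fun do rewrite !mxE.
  apply: cdiffM; first by apply: cdiffV; [exact: uz | exact: cdiff_det].
  apply: cdiffM; first exact: cdiff_cst.
  apply: cdiff_det => k l.
  by under eq_fun do rewrite !mxE; exact: dK.
apply: near_imp uK => z uz.
have -> : (\det (K z))^-1 *: \adj (K z) = invmx (K z) by rewrite /invmx uz.
by rewrite mulmxV ?mulVmx.
Qed.

End HolomorphicMatrices.

(** * Rigidity of nonincreasing exponent sequences *)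

(** Equality of the sums turns every inequality [m i <= nu (s i)] into an equality, so [nu] is a
    rearrangement of [m]; two nonincreasing lists with the same entries coincide. *)
Lemma antitone_perm_eq r (m : nat -> nat) (nu : 'I_r -> nat) (s : 'S_r) :
  (forall i j : 'I_r, (i <= j)%N -> (m j <= m i)%N) ->
  (forall i j : 'I_r, (i <= j)%N -> (nu j <= nu i)%N) ->
  (forall i : 'I_r, (m i <= nu (s i))%N) ->
  (\sum_(i < r) nu i = \sum_(i < r) m i)%N ->
  forall i : 'I_r, nu i = m i.
Proof.
move=> mS nuS mnu sum_eq.
have mE (i : 'I_r) : m i = nu (s i).
  have lei (k : 'I_r) : true -> (m k <= nu (s k) ?= iff (m k == nu (s k)))%N.
    by move=> _; split=> //; exact: mnu.
  have sum_nu : (\sum_(k < r) nu (s k) = \sum_(k < r) nu k)%N.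
    by rewrite [RHS](reindex_inj (@perm_inj _ s)).
  by have [_] := leqif_sum lei; rewrite sum_nu sum_eq eqxx => /esym/forallP/(_ i)/eqP.
have sortedF (f : 'I_r -> nat) : (forall i j : 'I_r, (i <= j)%N -> (f j <= f i)%N) ->
    sorted geq [seq f i | i <- enum 'I_r].
  move=> fS; rewrite sorted_map.
  have : sorted ltn (map val (enum 'I_r)) by rewrite val_enum_ord iota_ltn_sorted.
  by rewrite sorted_map; apply: sub_sorted => i j /ltnW; exact: fS.
have eq_map : [seq nu i | i <- enum 'I_r] = [seq m (val i) | i <- enum 'I_r].
  apply: (@sorted_eq _ geq).
  - by move=> x y z; rewrite /geq /= => h1 h2; exact: leq_trans h2 h1.
  - by move=> x y; rewrite /geq /= => h; apply/eqP; rewrite eqn_leq andbC.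
  - exact: sortedF.
  - exact: (sortedF (fun i : 'I_r => m i)).
  under [X in perm_eq _ X]eq_map do rewrite mE.
  rewrite [X in perm_eq _ X]map_comp; apply: perm_map.
  apply: uniq_perm; rewrite ?enum_uniq ?(map_inj_uniq (@perm_inj _ s)) ?enum_uniq //.
  move=> x; rewrite mem_enum inE; apply/esym/mapP.
  by exists ((s^-1)%g x); rewrite ?mem_enum ?permKV.
by move=> i; move/eq_in_map: eq_map => /(_ i); apply; rewrite mem_enum.
Qed.

Lemma col_mulmx (S : pzRingType) p q s (A : 'M[S]_(p, q)) (B : 'M[S]_(q, s)) j :
  col j (A *m B) = A *m col j B.
Proof. by rewrite !colE mulmxA. Qed.

(** * The diagonal matrix [Delta] and its canonical matrices *)

Section CanonicalMatrices.
Context {R : realType} (l0 : R[i]).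
Local Notation C := R[i].
Local Notation holo := (mx_holo_near l0).
Local Notation Delta := (Delta l0).

Lemma det_diag_expr r (nu : 'I_r -> nat) (x : C) :
  \det (diag_mx (\row_j x ^+ nu j)) = x ^+ (\sum_j nu j)%N.
Proof.
rewrite det_diag (big_morph _ (exprD x) (expr0 x)).
by apply: eq_bigr => j _; rewrite mxE.
Qed.

Lemma Delta_unit m r z : z != l0 -> Delta m r z \in unitmx.
Proof.
by move=> zl0; rewrite unitmxE unitfE det_diag_expr expf_neq0 // subr_eq0.
Qed.

Lemma tr_Delta m r z : (Delta m r z)^T = Delta m r z.
Proof. exact: tr_diag_mx. Qed.

Lemma mulDeltaE m r q (M : 'M[C]_(r, q)) z i j :
  (Delta m r z *m M) i j = (z - l0) ^+ m i * M i j.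
Proof. by rewrite mul_diag_mx !mxE. Qed.

Lemma Delta_block m r s z : (forall i, (r <= i < r + s)%N -> m i = 0%N) ->
  Delta m (r + s) z = block_mx (Delta m r z) 0 0 1%:M.
Proof.
move=> m0; rewrite -[1%:M]diag_const_mx.
rewrite -diag_mx_row; congr diag_mx; apply/rowP => i.
rewrite !mxE; case: split_ordP => j ->; rewrite !mxE //.
by rewrite m0 ?expr0 //= leq_addr ltn_add2l ltn_ord.
Qed.

(** The column of [W] with index [i] is the holomorphic cofactor that witnesses the order [nu i];
    this packs the separate multiplicities into one factorization. *)
Lemma zero_order_cols n p r (T : C -> 'M[C]_(p, n)) (Y : C -> 'M[C]_(n, r))
    (nu : 'I_r -> nat) :
  (forall i, zero_order l0 (fun z => T z *m col i (Y z)) (nu i)) ->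
  exists2 W : C -> 'M[C]_(p, r), holo W &
    \forall z \near (l0 : C^o),
      T z *m Y z = W z *m diag_mx (\row_j (z - l0) ^+ nu j).
Proof.
rewrite /zero_order => nuY; have [g hg] := boolp.choice nuY.
exists (fun z => \matrix_(i, j) g j z i 0).
  by apply: mx_holo_cols => j; have [] := hg j.
have : \forall z \near (l0 : C^o),
    forall j, T z *m col j (Y z) = (z - l0) ^+ nu j *: g j z.
  by apply: near_forall => j; have [_ []] := hg j.
apply: near_imp => z Tg; apply/matrixP => i j.
rewrite mul_mx_diag [RHS]mxE !mxE mulrC.
by have /matrixP/(_ i 0) := Tg j; rewrite -col_mulmx !mxE.
Qed.

(* The numbers [nu] of the definition are compared with [m] through a nonzero
   term of the Leibniz expansion of the determinant of the top block of [W]. *)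
Lemma diag_right_canonical r s m (Y : C -> 'M[C]_(r + s, r)) :
  (forall i j, (i <= j < r + s)%N -> (m j <= m i)%N) ->
  (forall i, (r <= i < r + s)%N -> m i = 0%N) ->
  right_canonical l0 (Delta m (r + s)) m Y ->
  exists W : C -> 'M[C]_(r + s, r),
    [/\ holo W,
        \forall z \near (l0 : C^o), Delta m (r + s) z *m Y z = W z *m Delta m r z,
        usubmx (W l0) \in unitmx, usubmx (Y l0) \in unitmx & dsubmx (Y l0) = 0].
Proof.
move=> mS m0 [hY [Y0 [fY [nu [nuY [sum_nu nuS]]]]]].
(* The lower block of [Delta] is the identity, so the kernel condition at [l0] kills the lower block
   of [Y l0]. The full rank of [Y l0] then sits in its upper block. *)
have Yd0 : dsubmx (Y l0) = 0.
  have EY0 : Delta m (r + s) l0 *m Y l0 = 0.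
    by apply/row_matrixP => i; apply/rowP => j;
       have [_ /matrixP/(_ i 0)] := Y0 j; rewrite -col_mulmx !mxE.
  move: EY0; rewrite -{1}[Y l0]vsubmxK Delta_block // mul_block_col.
  by rewrite !mul0mx mul1mx add0r addr0 -(col_mx0 _ r s r) => /eq_col_mx[].
have Yu0 : usubmx (Y l0) \in unitmx.
  move: fY; rewrite -[Y l0]vsubmxK Yd0 tr_col_mx trmx0 /row_free rank_row_mx0.
  by rewrite mxrank_tr col_mxKu -row_free_unit.
have [W hW EYW] := zero_order_cols nuY.
have EYu : \forall z \near (l0 : C^o),
    Delta m r z *m usubmx (Y z) =
      usubmx (W z) *m diag_mx (\row_j (z - l0) ^+ nu j).
  apply: near_imp EYW => z /(congr1 usubmx).
  rewrite -{1}[Y z]vsubmxK Delta_block // mul_block_col col_mxKu.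
  by rewrite mul0mx addr0 mul_usub_mx.
(* Off [l0] both diagonal factors have determinant [z - l0] to the common power [\sum_i m i], which
   cancels; continuity gives the value at [l0]. *)
have detE : \det (usubmx (Y l0)) = \det (usubmx (W l0)).
  apply: (@cdiff_eq_at _ (fun z => \det (usubmx (Y z)))
                         (fun z => \det (usubmx (W z)))).
  - exact: (cdiff_det (mx_holo_atP (mx_holo_usub hY))).
  - exact: (cdiff_det (mx_holo_atP (mx_holo_usub hW))).
  apply: near_imp EYu => z /(congr1 determinant) + zl0.
  rewrite !det_mulmx !det_diag_expr sum_nu mulrC; apply: mulIf.
  by rewrite expf_neq0 // subr_eq0.
have Wu0 : usubmx (W l0) \in unitmx by rewrite unitmxE -detE -unitmxE.
have [p Wp] : exists p : 'S_r, forall i, usubmx (W l0) i (p i) != 0.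
  apply: contrapT => noP; move: Wu0; rewrite unitmxE unitfE => /eqP; apply.
  rewrite /determinant big1 // => p _.
  have [i /negP] : exists i, ~ (usubmx (W l0) i (p i) != 0).
    by apply/existsNP => Wp; apply: noP; exists p.
  by rewrite negbK => /eqP Wi0; rewrite (bigD1 i) //= Wi0 mul0r mulr0.
have nuE : forall i : 'I_r, nu i = m i.
  apply: (@antitone_perm_eq _ _ _ p) => // [i j ij | i].
    by apply: mS; rewrite ij ltn_addr.
  (* If [nu (p i) < m i], cancelling powers of [z - l0] shows that the entry [(i, p i)] of [W] keeps
     a positive power of [z - l0] and vanishes at [l0], against the choice of [p]. *)
  rewrite leqNgt; apply: contra (Wp i) => ltnum; apply/eqP.
  pose F z := (z - l0) ^+ (m i - nu (p i)) * usubmx (Y z) i (p i).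
  suff -> : usubmx (W l0) i (p i) = F l0.
    by rewrite /F subrr expr0n subn_eq0 leqNgt ltnum mul0r.
  apply: (@cdiff_eq_at _ (fun z => usubmx (W z) i (p i)) F).
  - exact: (mx_holo_atP (mx_holo_usub hW)).
  - apply: cdiffM; first exact/cdiffX/cdiff_subl0.
    exact: (mx_holo_atP (mx_holo_usub hY)).
  apply: near_imp EYu => z /matrixP/(_ i (p i)) + zl0.
  rewrite mulDeltaE mul_mx_diag [RHS]mxE [X in _ = _ * X]mxE => eqz.
  have x0 : (z - l0) ^+ nu (p i) != 0 by rewrite expf_neq0 // subr_eq0.
  by apply: (mulIf x0); rewrite -eqz /F mulrAC -exprD subnK // ltnW.
exists W; split=> //; apply: near_imp EYW => z ->; congr (_ *m diag_mx _).
by apply/rowP => j; rewrite !mxE nuE.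
Qed.

(** * Invariance of canonical matrices under transposition and local equivalence *)

Lemma right_canonical_tr n r m (T : C -> 'M[C]_n) (Y : C -> 'M[C]_(n, r)) :
  right_canonical l0 T m Y ->
  left_canonical l0 (fun z => (T z)^T) m (fun z => (Y z)^T).
Proof.
move=> [hY [Y0 [fY [nu [nuY nuS]]]]]; split; first exact: mx_holo_tr.
split.
  move=> i; have [yi Tyi] := Y0 i; rewrite -tr_col -trmx_mul Tyi trmx0; split=> //.
  by rewrite -trmx0 (inj_eq trmx_inj).
split=> //; exists nu; split=> // i; have [g [hg [g0 gE]]] := nuY i.
exists (fun z => (g z)^T); split; first exact: mx_holo_tr.
split; first by rewrite -trmx0 (inj_eq trmx_inj).
by apply: near_imp gE => z gz; rewrite -tr_col -trmx_mul gz linearZ.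
Qed.

Lemma left_canonical_tr n r m (T : C -> 'M[C]_n) (V : C -> 'M[C]_(r, n)) :
  left_canonical l0 T m V ->
  right_canonical l0 (fun z => (T z)^T) m (fun z => (V z)^T).
Proof.
move=> [hV [V0 [fV [nu [nuV nuS]]]]]; split; first exact: mx_holo_tr.
split.
  move=> i; have [vi Tvi] := V0 i; rewrite -tr_row -trmx_mul Tvi trmx0; split=> //.
  by rewrite -trmx0 (inj_eq trmx_inj).
split; first by rewrite trmxK.
exists nu; split=> // i; have [g [hg [g0 gE]]] := nuV i.
exists (fun z => (g z)^T); split; first exact: mx_holo_tr.
split; first by rewrite -trmx0 (inj_eq trmx_inj).
by apply: near_imp gE => z gz; rewrite -tr_row -trmx_mul gz linearZ.
Qed.

(** This moves a canonical matrix into Smith coordinates. The invertible [Bi l0] keeps the columns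
    independent, and the invertible [A l0] keeps the leading cofactors nonzero, so the orders do not
    change. *)
Lemma right_canonical_equiv n r m (T E A B Bi : C -> 'M[C]_n)
    (Y : C -> 'M[C]_(n, r)) :
  unimodular l0 A -> holo Bi ->
  (\forall z \near (l0 : C^o), B z *m Bi z = 1%:M) ->
  (\forall z \near (l0 : C^o), E z = A z *m T z *m B z) ->
  right_canonical l0 T m Y -> right_canonical l0 E m (fun z => Bi z *m Y z).
Proof.
move=> [hA [Ai [_ AAi]]] hBi BBi EE [hY [Y0 [fY [nu [nuY nuS]]]]].
have B0 := nbhs_singleton BBi; have E0 := nbhs_singleton EE.
have A0 : A l0 \in unitmx by have [/mulmx1_unit[]] := nbhs_singleton AAi.
split; first exact: mx_holoM.
split.
  move=> i; have [yi Tyi] := Y0 i; rewrite col_mulmx; split.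
    apply: contra_neq yi => yi.
    by rewrite -[col _ _]mul1mx -B0 -mulmxA yi mulmx0.
  by rewrite E0 -!mulmxA (mulmxA (B l0)) B0 mul1mx Tyi mulmx0.
split.
  rewrite /row_free trmx_mul mxrankMfree // row_free_unit unitmx_tr.
  by have [] := mulmx1_unit B0.
exists nu; split=> // i; have [g [hg [g0 gE]]] := nuY i.
exists (fun z => A z *m g z); split; first exact: mx_holoM.
split.
  by apply: contra_neq g0 => Ag; rewrite -[g l0](mulKmx A0) Ag mulmx0.
have gE' := near_and gE BBi.
apply: near_imp2 gE' EE => z [gz Bz] ->.
rewrite col_mulmx -mulmxA (mulmxA (B z)) Bz mul1mx -mulmxA gz.
by rewrite scalemxAr.
Qed.

(* Comparing determinants off [l0] in [Delta (Z Y) = V T Y = (V W) Delta]. *)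
Lemma factor_unit n r m (T : C -> 'M[C]_n) (V Z : C -> 'M[C]_(r, n))
    (Y W : C -> 'M[C]_(n, r)) :
  holo V -> holo Y -> holo W -> holo Z ->
  (\forall z \near (l0 : C^o), T z *m Y z = W z *m Delta m r z) ->
  (\forall z \near (l0 : C^o), V z *m T z = Delta m r z *m Z z) ->
  V l0 *m W l0 \in unitmx -> Z l0 *m Y l0 \in unitmx.
Proof.
move=> hV hY hW hZ TY VT; rewrite !unitmxE => VW.
suff -> : \det (Z l0 *m Y l0) = \det (V l0 *m W l0) by [].
apply: (@cdiff_eq_at _ (fun z => \det (Z z *m Y z)) (fun z => \det (V z *m W z))).
- exact: (cdiff_det (mx_holo_atP (mx_holoM hZ hY))).
- exact: (cdiff_det (mx_holo_atP (mx_holoM hV hW))).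
apply: near_imp2 TY VT => z TY VT zl0.
have /(congr1 determinant) : Delta m r z *m (Z z *m Y z) = V z *m W z *m Delta m r z.
  by rewrite mulmxA -VT -!mulmxA TY.
rewrite !det_mulmx [RHS]mulrC; apply: mulfI.
by rewrite -unitfE -unitmxE Delta_unit.
Qed.

(** * Normalized canonical matrices and divisibility by [Delta] *)

(** Off [l0] one has [V T Y = Delta (Z Y)], so the expression equals [Y (Z Y)^-1], which is
    holomorphic at [l0]. Its columns are independent at [l0] because [Z l0] is a left inverse
    there. *)
Lemma right_canonical_normalize n r (m : nat -> nat)
    (T : C -> 'M[C]_n) (V Z : C -> 'M[C]_(r, n)) (Y W : C -> 'M[C]_(n, r)) :
  (forall i j : 'I_r, (i <= j)%N -> (m j <= m i)%N) ->
  holo V -> holo Y -> holo W -> holo Z ->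
  (\forall z \near (l0 : C^o), T z *m Y z = W z *m Delta m r z) ->
  (\forall z \near (l0 : C^o), V z *m T z = Delta m r z *m Z z) ->
  V l0 *m W l0 \in unitmx -> T l0 *m Y l0 = 0 ->
  germ_holo_with l0
    (fun z => Y z *m invmx (V z *m T z *m Y z) *m Delta m r z)
    (fun Yh => right_canonical l0 T m Yh).
Proof.
move=> mS hV hY hW hZ TY VT VW TY0.
have ZY := factor_unit hV hY hW hZ TY VT VW.
have [_ [Ki [hKi KKi]]] := unimodular_unit (mx_holoM hV hW) VW.
have [_ [Li [hLi LLi]]] := unimodular_unit (mx_holoM hZ hY) ZY.
have [K0 _] := nbhs_singleton KKi; have [L0 _] := nbhs_singleton LLi.
exists (fun z => Y z *m Li z); split; last first.
  apply: near_imp2 VT LLi => z VT [LL _] zl0.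
  have NE : V z *m T z *m Y z = Delta m r z *m (Z z *m Y z).
    by rewrite VT mulmxA.
  have uN : V z *m T z *m Y z \in unitmx.
    by rewrite NE unitmx_mul (Delta_unit _ _ zl0); have [-> _] := mulmx1_unit LL.
  rewrite -mulmxA; congr (_ *m _).
  have DE : Delta m r z = (V z *m T z *m Y z) *m Li z.
    by rewrite NE -mulmxA LL mulmx1.
  by rewrite [in RHS]DE mulKmx.
have free0 : (Z l0 *m (Y l0 *m Li l0)) = 1%:M by rewrite mulmxA.
split; first exact: mx_holoM.
split.
  move=> i; split; last by rewrite -col_mulmx mulmxA TY0 mul0mx col0.
  apply/eqP => ci; have /eqP := oner_neq0 C; apply.
  have /(congr1 (col i)) := free0; rewrite col_mulmx ci mulmx0.
  by move/matrixP/(_ i 0); rewrite !mxE eqxx.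
split.
  by apply/row_freeP; exists (Z l0)^T; rewrite -trmx_mul free0 trmx1.
exists (fun i : 'I_r => m i); split=> // i.
(* The order is exactly [m i]: the cofactor is nonzero at [l0] because [V l0] is a left inverse of
   [W l0 *m Ki l0]. *)
exists (fun z => col i (W z *m Ki z)); split.
  have -> : (fun z => col i (W z *m Ki z)) = (fun z => W z *m Ki z *m delta_mx i 0).
    by apply/funext => z; rewrite colE.
  by apply: mx_holoM; [exact: mx_holoM | exact: mx_holo_cst].
split.
  apply/eqP => ci; have /eqP := oner_neq0 C; apply.
  have := K0; rewrite -mulmxA => /(congr1 (col i)); rewrite col_mulmx ci mulmx0.
  by move/matrixP/(_ i 0); rewrite !mxE eqxx.
have KL := near_and KKi LLi.
have TV := near_and TY VT.
apply: near_imp2 KL TV => z [[_ KK] [LL _]] [TYz VTz].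
(* Multiply [Delta (Z Y) = (V W) Delta] by [Ki] on the left and by [Li] on the right. *)
have DE : Ki z *m Delta m r z = Delta m r z *m Li z.
  have EE : Delta m r z *m (Z z *m Y z) = V z *m W z *m Delta m r z.
    by rewrite mulmxA -VTz -!mulmxA TYz.
  rewrite -[LHS]mulmx1 -LL (mulmxA _ _ (Li z)) -(mulmxA (Ki z)) EE.
  by rewrite mulmxA KK mul1mx.
rewrite -col_mulmx mulmxA TYz -mulmxA -DE mulmxA; apply/colP => k.
by rewrite mxE mul_mx_diag [LHS]mxE [X in _ * X]mxE [RHS]mxE mulrC [in RHS]mxE.
Qed.

(** Only the upper block [P1] of [P] has to be divided. Blockwise, [V1 Delta = Delta H1],
    [V2 = Delta H2] and [V1 P1 = - V2 P2]; hence [P1 = - Delta H1^-1 H2 P2]. *)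
Lemma Delta_solve r s q (m : nat -> nat)
    (V H : C -> 'M[C]_(r, r + s)) (P : C -> 'M[C]_(r + s, q)) :
  (forall i, (r <= i < r + s)%N -> m i = 0%N) ->
  holo V -> holo H -> holo P ->
  (\forall z \near (l0 : C^o), V z *m Delta m (r + s) z = Delta m r z *m H z) ->
  lsubmx (V l0) \in unitmx -> lsubmx (H l0) \in unitmx ->
  (\forall z \near (l0 : C^o), V z *m P z = 0) ->
  exists2 X : C -> 'M[C]_(r + s, q), holo X &
    \forall z \near (l0 : C^o), Delta m (r + s) z *m X z = P z.
Proof.
move=> m0 hV hH hP VE uV uH VP.
have nV := unitmx_near (mx_holo_lsub hV) uV.
have [_ [Hi [hHi HHi]]] := unimodular_unit (mx_holo_lsub hH) uH.
exists (fun z => col_mx (0 - Hi z *m (rsubmx (H z) *m dsubmx (P z))) (dsubmx (P z))).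
  apply: mx_holo_col_mx; last exact: mx_holo_dsub.
  apply: mx_holoB; first exact: mx_holo_cst.
  apply: mx_holoM => //; apply: mx_holoM; first exact: mx_holo_rsub.
  exact: mx_holo_dsub.
have VEP := near_and VE VP.
have VHi := near_and nV HHi.
apply: near_imp2 VEP VHi => z [VEz VPz] [uVz [HHz _]].
rewrite -[RHS]vsubmxK Delta_block // mul_block_col !mul0mx mul1mx addr0 add0r.
congr col_mx; last by rewrite add0r.
rewrite mulmxN; apply: (can_inj (mulKmx uVz)).
move: VEz; rewrite -[V z]hsubmxK -[H z]hsubmxK Delta_block // mul_row_block.
rewrite mul_mx_row !mulmx0 mulmx1 addr0 add0r !hsubmxK => /eq_row_mx[VlE VrE].
move: VPz; rewrite -[V z]hsubmxK -[P z]vsubmxK mul_row_col !hsubmxK !vsubmxK.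
move=> /(canRL (addrK _)); rewrite sub0r => ->.
rewrite mulmxN (mulmxA (lsubmx (V z))) VlE -(mulmxA (Delta m r z)).
by rewrite (mulmxA (lsubmx (H z))) HHz mul1mx mulmxA -VrE.
Qed.

End CanonicalMatrices.

(** * Block products and the Smith exponents beyond the kernel dimension *)

Lemma mulmx_tr_dsub0 (S : pzRingType) r s p q (M : 'M[S]_(r + s, p))
    (N : 'M[S]_(r + s, q)) :
  dsubmx M = 0 -> M^T *m N = (usubmx M)^T *m usubmx N.
Proof.
move=> M0; rewrite -{1}[M]vsubmxK -{1}[N]vsubmxK tr_col_mx mul_row_col M0.
by rewrite trmx0 mul0mx addr0.
Qed.

(** By rank-nullity the Smith form at [l0] has rank [s]. If [m i > 0] with [i >= r], monotonicity
    makes all rows up to [i] vanish; the lower [s] rows carry the whole rank, yet one of them is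
    zero. *)
Lemma smith_exponent_eq0 (R : realType) (l0 : R[i]) r s (m : nat -> nat)
    (T A B : 'M[R[i]]_(r + s)) :
  (forall i j, (i <= j < r + s)%N -> (m j <= m i)%N) ->
  A \in unitmx -> B \in unitmx -> A *m T *m B = Delta l0 m (r + s) l0 ->
  r = \rank (kermx T^T) -> forall i, (r <= i < r + s)%N -> m i = 0%N.
Proof.
move=> mS uA uB ATB rE i /andP[ri irs]; apply/eqP; rewrite -leqn0 leqNgt.
apply/negP => mi.
have rankT : \rank T = s.
  have := rank_leq_row T; move: rE; rewrite mxrank_ker mxrank_tr.
  by move=> rE Tle; apply/eqP; rewrite -(eqn_add2l r) {1}rE subnK.
have rankD : \rank (Delta l0 m (r + s) l0) = s.
  rewrite -ATB mxrankMfree ?row_free_unit //.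
  by rewrite -mxrank_tr trmx_mul mxrankMfree ?row_free_unit ?unitmx_tr // mxrank_tr.
have D0 (k : 'I_(r + s)) j : (k <= i)%N -> Delta l0 m (r + s) l0 k j = 0.
  move=> ki; rewrite !mxE subrr expr0n.
  have := mS k i; rewrite ki irs => /(_ isT) /(leq_trans mi).
  by case: (m k) => // ?; rewrite mul0rn.
have Du : usubmx (Delta l0 m (r + s) l0) = 0.
  apply/matrixP => a b; rewrite [LHS]mxE [RHS]mxE D0 //=.
  by apply: ltnW; apply: leq_trans (ltn_ord a) ri.
have is_ : (i - r < s)%N by rewrite ltn_subLR.
have : row_free (dsubmx (Delta l0 m (r + s) l0)).
  apply/eqP; rewrite -[RHS]rankD -[in RHS](vsubmxK (Delta l0 m (r + s) l0)) Du.
  by rewrite rank_col_0mx.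
case/row_freeP => X /matrixP/(_ (Ordinal is_) (Ordinal is_)); rewrite mxE big1.
  by rewrite mxE eqxx => /esym/eqP; rewrite oner_eq0.
by move=> k _; rewrite mxE D0 ?mul0r //= subnKC.
Qed.

(** * Biorthogonality and the principal part of the inverse *)

Unset Implicit Arguments.

Theorem mainTheorem1 (R : realType) (Omega : set R[i]^o) (l0 : R[i]) (n : nat)
  (T : R[i] -> 'M[R[i]]_n) (m : nat -> nat) (r : nat)
  (V : R[i] -> 'M[R[i]]_(r, n)) (Y : R[i] -> 'M[R[i]]_(n, r)) :
  (* Omega is a domain, l0 in Omega *)
  open Omega -> connected Omega -> Omega l0 ->
  (* T in H^{n x n}, det T not identically zero, det T(l0) = 0 *)
  mx_holoOn Omega T ->
  (exists z, Omega z /\ \det (T z) != 0) ->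
  \det (T l0) = 0 ->
  (* m_0 >= ... >= m_{n-1} are the partial multiplicities (local Smith form) *)
  (forall i j, (i <= j < n)%N -> (m j <= m i)%N) ->
  (exists UL UR : R[i] -> 'M[R[i]]_n,
     unimodular l0 UL /\ unimodular l0 UR /\
     \forall z \near (l0 : R[i]^o),
       UL z *m T z *m UR z = diag_mx (\row_(i < n) (z - l0) ^+ m i)) ->
  (* r = dim ker T(l0) *)
  r = \rank (kermx (T l0)^T) ->
  (* V, Y in H, left / right canonical matrices *)
  mx_holoOn Omega V -> left_canonical l0 T m V ->
  mx_holoOn Omega Y -> right_canonical l0 T m Y ->
  let VTY := fun z => V z *m T z *m Y z in
  let D := Delta l0 m r in
  let Yhat := fun z => Y z *m invmx (VTY z) *m D z in
  let Vhat := fun z => D z *m invmx (VTY z) *m V z in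
  (* VTY is invertible as a meromorphic matrix *)
  ~ (forall z, Omega z -> \det (VTY z) = 0) /\
  (* (i) *)
  (germ_holo_with l0 Yhat (fun Yh => right_canonical l0 T m Yh) /\
   peq l0 (fun z => invmx (D z) *m V z *m T z *m Yhat z *m invmx (D z))
          (fun z => invmx (D z))) /\
  (* (ii) *)
  (germ_holo_with l0 Vhat (fun Vh => left_canonical l0 T m Vh) /\
   peq l0 (fun z => invmx (D z) *m Vhat z *m T z *m Y z *m invmx (D z))
          (fun z => invmx (D z))) /\
  (* (iii) *)
  peq l0 (fun z => invmx (T z)) (fun z => Y z *m invmx (VTY z) *m V z).
Proof.
move=> oO _ Ol0 _ _ _ mS [A [B [unA [unB ATB]]]] rE _ canV _ canY.
have [s ns] : exists s, n = (r + s)%N.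
  by exists (n - r)%N; rewrite subnKC // rE mxrank_ker leq_subr.
subst n; move=> VTY D Yhat Vhat.
have [hA [Ai [hAi AAi]]] := unA; have [hB [Bi [hBi BBi]]] := unB.
have [A0 _] := nbhs_singleton AAi; have [B0 _] := nbhs_singleton BBi.
have uA : A l0 \in unitmx by have [] := mulmx1_unit A0.
have uB : B l0 \in unitmx by have [] := mulmx1_unit B0.
have m0 := smith_exponent_eq0 mS uA uB (nbhs_singleton ATB) rE.
have mSr (i j : 'I_r) : (i <= j)%N -> (m j <= m i)%N.
  by move=> ij; apply: mS; rewrite ij ltn_addr.
have [hY [Y0 _]] := canY; have [hV [V0 _]] := canV.
have [W' [hW' EY' uW' _ Yd]] : exists W' : R[i] -> 'M[R[i]]_(r + s, r),
    [/\ mx_holo_near l0 W',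
        \forall z \near (l0 : R[i]^o),
          Delta l0 m (r + s) z *m (Bi z *m Y z) = W' z *m D z,
        usubmx (W' l0) \in unitmx, usubmx (Bi l0 *m Y l0) \in unitmx
      & dsubmx (Bi l0 *m Y l0) = 0].
  apply: (diag_right_canonical mS m0).
  apply: (right_canonical_equiv (A := A) (B := B) (T := T)) => //.
    by apply: near_imp BBi => z [].
  by apply: near_imp ATB => z ->.
(* The same argument for the transposed problem: [Delta] is symmetric, so [B^T T^T A^T] is again the
   Smith form and [V^T] becomes a right canonical matrix. *)
have [G [hG EVG uG uV' Vd]] : exists G : R[i] -> 'M[R[i]]_(r + s, r),
    [/\ mx_holo_near l0 G,
        \forall z \near (l0 : R[i]^o),
          Delta l0 m (r + s) z *m ((Ai z)^T *m (V z)^T) = G z *m D z,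
        usubmx (G l0) \in unitmx, usubmx ((Ai l0)^T *m (V l0)^T) \in unitmx
      & dsubmx ((Ai l0)^T *m (V l0)^T) = 0].
  apply: (diag_right_canonical (Y := fun z => (Ai z)^T *m (V z)^T) mS m0).
  apply: (right_canonical_equiv (A := fun z => (B z)^T) (B := fun z => (A z)^T)
    (T := fun z => (T z)^T) (Bi := fun z => (Ai z)^T) (Y := fun z => (V z)^T)).
  - split; first exact: mx_holo_tr.
    exists (fun z => (Bi z)^T); split; first exact: mx_holo_tr.
    by apply: near_imp BBi => z [BB1 BB2]; rewrite -!trmx_mul BB1 BB2 trmx1.
  - exact: mx_holo_tr.
  - by apply: near_imp AAi => z [_ AA]; rewrite -trmx_mul AA trmx1.
  - apply: near_imp ATB => z ATBz.
    by rewrite -tr_Delta -!trmx_mul mulmxA; congr trmx; exact/esym.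
  - exact: left_canonical_tr.
(* Back in the original coordinates, these are the cofactors in [T Y = W D] and [V T = D Z]. *)
pose W z := Ai z *m W' z; pose Z z := (G z)^T *m Bi z.
have hW : mx_holo_near l0 W by exact: mx_holoM.
have hZ : mx_holo_near l0 Z by apply: mx_holoM; [exact: mx_holo_tr | exact: hBi].
have TE : \forall z \near (l0 : R[i]^o), T z = Ai z *m Delta l0 m (r + s) z *m Bi z.
  have AB := near_and AAi BBi.
  apply: near_imp2 AB ATB => z [[_ AA] [BB _]].
  by rewrite /Delta => <-; rewrite -!mulmxA BB mulmx1 mulmxA AA mul1mx.
have VE : \forall z \near (l0 : R[i]^o),
    V z *m Ai z *m Delta l0 m (r + s) z = D z *m (G z)^T.
  apply: near_imp EVG => z /(congr1 trmx).
  by rewrite !trmx_mul !trmxK !tr_Delta.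
have TY : \forall z \near (l0 : R[i]^o), T z *m Y z = W z *m D z.
  by apply: near_imp2 TE EY' => z -> EYz; rewrite /W -!mulmxA EYz.
have VT : \forall z \near (l0 : R[i]^o), V z *m T z = D z *m Z z.
  by apply: near_imp2 TE VE => z -> VEz; rewrite /Z !mulmxA VEz.
(* At [l0] the last [s] columns of [V Ai] vanish, so [V W] reduces to a product of two invertible
   [r] by [r] blocks. *)
have VW : V l0 *m W l0 \in unitmx.
  rewrite /W mulmxA -[V l0 *m Ai l0]trmxK trmx_mul (mulmx_tr_dsub0 _ Vd).
  by rewrite unitmx_mul unitmx_tr uV' uW'.
have TY0 : T l0 *m Y l0 = 0.
  apply/matrixP => i j; have [_ /matrixP/(_ i 0)] := Y0 j.
  by rewrite -col_mulmx !mxE.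
have VT0 : V l0 *m T l0 = 0.
  by apply/row_matrixP => i; have [_] := V0 i; rewrite row_mul row0.
have ZY : Z l0 *m Y l0 \in unitmx := factor_unit hV hY hW hZ TY VT VW.
have uL := unitmx_near (mx_holoM hZ hY) ZY.
have uN : \forall z \near (l0 : R[i]^o), z != l0 -> VTY z \in unitmx.
  apply: near_imp2 VT uL => z VTz uLz zl0.
  by rewrite /VTY VTz -mulmxA unitmx_mul uLz (Delta_unit _ _ zl0).
have uT : \forall z \near (l0 : R[i]^o), z != l0 -> T z \in unitmx.
  have AB := near_and AAi BBi.
  apply: near_imp2 TE AB => z -> [[AA _] [BB _]] zl0.
  rewrite !unitmx_mul (Delta_unit _ _ zl0).
  by have [_ ->] := mulmx1_unit AA; have [_ ->] := mulmx1_unit BB.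
split.
  move=> det0.
  have nO : \forall z \near (l0 : R[i]^o), Omega z.
    exact: (@open_nbhs_nbhs R[i]^o l0 Omega (conj oO Ol0)).
  have pl0 : (l0 : R[i]^o)^' (fun z => z != l0) by exact: (@nbhs_dnbhs_neq R[i]^o l0).
  have [z [[zl0 uNz] Oz]] := filter_ex
    (filterI (filterI pl0 (nbhs_dnbhs uN)) (nbhs_dnbhs nO)).
  by have := uNz zl0; rewrite unitmxE det0 // unitr0.
split; [split | split; [split|]].
- exact: (right_canonical_normalize mSr hV hY hW hZ TY VT VW TY0).
(* Off [l0] the two sides agree exactly, so the holomorphic difference is zero. *)
- exists (fun=> 0); split; first exact: mx_holo_cst.
  apply: near_imp uN => z uNz zl0; apply/eqP; rewrite subr_eq0 /Yhat !mulmxA.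
  rewrite -(mulmxA _ (V z)) -(mulmxA _ (V z *m T z)) -(mulmxA _ (VTY z)).
  by rewrite (mulmxV (uNz zl0)) mulmx1 (mulVmx (Delta_unit _ _ zl0)) mul1mx.
(* Statement (ii) is (i) for [T^T], with [Y^T] and [V^T] exchanging roles and likewise [Z^T] and
   [W^T]. *)
- have [Mh [canM ME]] : germ_holo_with l0
      (fun z => (V z)^T *m invmx ((Y z)^T *m (T z)^T *m (V z)^T) *m D z)
      (fun Yh => right_canonical l0 (fun z => (T z)^T) m Yh).
    apply: (right_canonical_normalize (W := fun z => (Z z)^T)
      (Z := fun z => (W z)^T) (V := fun z => (Y z)^T)).
    + exact: mSr.
    + exact: mx_holo_tr.
    + exact: mx_holo_tr.
    + exact: mx_holo_tr.
    + exact: mx_holo_tr.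
    + by apply: near_imp VT => z /(congr1 trmx); rewrite !trmx_mul tr_Delta.
    + by apply: near_imp TY => z /(congr1 trmx); rewrite !trmx_mul tr_Delta.
    + by rewrite -trmx_mul unitmx_tr.
    + by rewrite -trmx_mul VT0 trmx0.
  exists (fun z => (Mh z)^T); split.
    have := right_canonical_tr canM.
    by rewrite (_ : (fun z => (T z)^T^T) = T) //; apply/funext => z; rewrite trmxK.
  apply: near_imp ME => z Mz zl0; rewrite Mz // !trmx_mul trmxK trmx_inv tr_Delta.
  by rewrite !trmx_mul !trmxK !mulmxA.
- exists (fun=> 0); split; first exact: mx_holo_cst.
  apply: near_imp uN => z uNz zl0; apply/eqP; rewrite subr_eq0 /Vhat !mulmxA.
  rewrite mulVmx ?mul1mx; last exact: Delta_unit.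
  by rewrite -(mulmxA _ (V z)) -(mulmxA _ (V z *m T z)) (mulVmx (uNz zl0)) mul1mx.
have [_ [Ki [hKi KKi]]] := unimodular_unit (mx_holoM hV hW) VW.
pose P z := 1%:M - W z *m Ki z *m V z.
have hP : mx_holo_near l0 P.
  apply: mx_holoB; first exact: mx_holo_cst.
  by apply: mx_holoM; [exact: mx_holoM | exact: hV].
(* In Smith coordinates [T^-1 P] is [B X] with [Delta X = A P]; [V P = 0] makes this solvable with
   [X] holomorphic. *)
have [X hX EX] : exists2 X : R[i] -> 'M[R[i]]_(r + s), mx_holo_near l0 X &
    \forall z \near (l0 : R[i]^o), Delta l0 m (r + s) z *m X z = A z *m P z.
  apply: (Delta_solve (V := fun z => V z *m Ai z) (H := fun z => (G z)^T)).
  - exact: m0.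
  - exact: mx_holoM.
  - exact: mx_holo_tr.
  - exact: mx_holoM.
  - exact: VE.
  - rewrite -unitmx_tr trmx_lsub trmx_mul; exact: uV'.
  - rewrite -trmx_usub unitmx_tr; exact: uG.
  - apply: near_imp2 AAi KKi => z [_ AA] [KK _].
    rewrite mulmxA -(mulmxA (V z)) AA mulmx1 /P mulmxBr mulmx1.
    by rewrite (mulmxA (V z)) (mulmxA (V z) (W z)) KK mul1mx subrr.
(* The minus sign comes from [peq], which subtracts its first argument from its second: the
   difference is [- T^-1 P]. *)
exists (fun z => 0 - B z *m X z); split.
  by apply: mx_holoB; [exact: mx_holo_cst | exact: mx_holoM].
have F1 := near_and (near_and TE EX) (near_and AAi BBi).
have F2 := near_and (near_and uT uN) (near_and TY KKi).
apply: near_imp2 F1 F2 => z [[TEz EXz] [[_ AA] [_ BB]]].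
move=> [[uTz uNz] [TYz [_ KK2]]] zl0.
have {}uTz := uTz zl0; have {}uNz := uNz zl0.
apply: (can_inj (mulKmx uTz)).
have NE : VTY z = V z *m W z *m D z by rewrite /VTY -(mulmxA (V z)) TYz (mulmxA (V z)).
have DN : D z *m invmx (VTY z) = Ki z.
  rewrite -[LHS]mul1mx -KK2 -(mulmxA (Ki z)) (mulmxA _ (D z)) -NE.
  by rewrite (mulmxV uNz) mulmx1.
have TYN : T z *m (Y z *m invmx (VTY z) *m V z) = W z *m Ki z *m V z.
  by rewrite !mulmxA TYz -(mulmxA (W z) (D z)) DN.
rewrite mulmxBr TYN (mulmxV uTz) sub0r mulmxN.
have -> : T z *m (B z *m X z) = P z.
  by rewrite TEz -!mulmxA (mulmxA (Bi z)) BB mul1mx EXz mulmxA AA mul1mx.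
by rewrite /P opprB.
Qed.
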